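(* Let $p$ be an odd prime. For every $r\ge1$ and every $1\le k\le r$, $$s(p^r)\le r-k\iff p^{j}\mid E_{r-j}\ \text{ for every } j \text{ with } 1\le j\le k,$$ i.e. if and only if $p\mid E_{r-1}$, $p^2\mid E_{r-2}$, $\dots$, $p^k\mid E_{r-k}$.
   Context: For $n\ge 0$, $E_n$ denotes the $n$-th Euler up/down (zig-zag) number, i.e. the number of alternating permutations of $\{1,\dots,n\}$; equivalently, the $E_n$ are the integers determined by $\sum_{n\ge0}E_n z^n/n!=\sec z+\tan z$. A positive integer $P$ is an eventual period of a sequence $(a_n)_{n\ge0}$ if there is $t\ge0$ with $a_{n+P}=a_n$ for all $n\ge t$. For every integer $q\ge1$ the sequence $(E_n\bmod q)_{n\ge0}$ has an eventual period. Its preperiod $s(q)$ is the least integer $t\ge0$ such that $E_{n+P}\equiv E_n\pmod q$ for all $n\ge t$, where $P$ is an eventual period of the sequence (the value does not depend on the choice of $P$; one may take $P$ to be the minimal eventual period). *)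

(* Defs.v *)
From mathcomp Require Import all_boot fingroup perm.
From mathcomp Require Import boolp classical_sets.

Set Implicit Arguments.
Unset Strict Implicit.
Unset Printing Implicit Defensive.

(* Up/down convention s(0) < s(1) > s(2) < ..., with positions and values
   shifted from {1, ..., n} to {0, ..., n - 1}. *)
Definition alternating (n : nat) (s : 'S_n) : bool :=
  [forall i : 'I_n, forall j : 'I_n, (j == i.+1 :> nat) ==>
     (if odd i then s j < s i else s i < s j)].

Definition euler_zigzag (n : nat) : nat := #|[pred s : 'S_n | alternating s]|.

Definition periodic_from (a : nat -> nat) (P t : nat) : Prop :=
  forall n, t <= n -> a (n + P) = a n.

Definition eventual_period (a : nat -> nat) (P : nat) : Prop :=
  0 < P /\ exists t, periodic_from a P t.

Definition is_preperiod (a : nat -> nat) (t : nat) : Prop :=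
  exists P, [/\ eventual_period a P, periodic_from a P t &
                forall u, periodic_from a P u -> t <= u].

(* The value 0 is taken when a has no eventual period; otherwise preperiodP
   below shows that any eventual period P computes the preperiod. *)
Definition preperiod (a : nat -> nat) : nat :=
  xget 0 [set t | is_preperiod a t]%classic.

Definition euler_preperiod (q : nat) : nat :=
  preperiod (fun n => euler_zigzag n %% q).

Lemma periodic_from_mul (a : nat -> nat) (P t m : nat) :
  periodic_from a P t -> periodic_from a (m * P) t.
Proof.
move=> aP; elim: m => [|m IHm] n le_tn; first by rewrite mul0n addn0.
by rewrite mulSn addnCA addnC aP ?IHm // (leq_trans le_tn) ?leq_addr.
Qed.

Lemma periodic_from_indep (a : nat -> nat) (P Q t : nat) :
  eventual_period a P -> periodic_from a Q t -> 0 < Q -> periodic_from a P t.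
Proof.
move=> [_ [u aP]] aQ Q_gt0 n le_tn; have aQu := periodic_from_mul u aQ.
rewrite -(aQu n le_tn) -(aQu (n + P)) ?(leq_trans le_tn) ?leq_addr //.
by rewrite addnAC aP // (leq_trans _ (leq_addl _ _)) // leq_pmulr.
Qed.

Lemma preperiodP (a : nat -> nat) (P : nat) : eventual_period a P ->
  periodic_from a P (preperiod a) /\
  forall u, periodic_from a P u -> preperiod a <= u.
Proof.
move=> perP; have [P_gt0 exP] := perP.
have ex_t : exists t, `[< periodic_from a P t >].
  by have [t Pt] := exP; exists t; apply/asboolP.
have ex_pre : is_preperiod a (ex_minn ex_t).
  case: ex_minnP => t /asboolP Pt t_min; exists P; split=> // u Pu.
  by apply/t_min/asboolP.
have [Q [perQ Qt Qmin]] : is_preperiod a (preperiod a).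
  exact: (@xgetPex _ 0 [set t | is_preperiod a t]%classic
            (ex_intro _ _ ex_pre)).
have Q_gt0 : 0 < Q by case: perQ.
split=> [|u Pu]; first exact: (periodic_from_indep perP Qt).
exact/Qmin/(periodic_from_indep perQ Pu).
Qed.

(* Main.v *)
From HB Require Import structures.
Require Import Defs.
From mathcomp Require Import all_boot.
From mathcomp Require Import fingroup perm all_algebra cyclic zify ring.

Set Implicit Arguments.
Unset Strict Implicit.
Unset Printing Implicit Defensive.

(** The idea is that E_n, once its Euler factor at p is removed, is purely
periodic modulo p^r.  Expanding (1 + sin z) / cos z in powers of exp (i z)
suggests that E_n is, up to sign, 2 S with S the divergent alternating sum of
the t^n over the t of parity opposite to n, namely 1^n - 3^n + 5^n - ... for n
even and 2^n - 4^n + 6^n - ... for n odd.  Modulo an odd N, 2 S is the sum of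
the first N terms [zigzag_power_sum]: what remains of S after them is - S,
because the shift of t by 2N does not change t^n modulo N, while N is odd.

Take N = p^(r+1).  The multiples of p among the t form the same kind of sum,
of length p^r, multiplied by p^n and by a sign eps that depends only on p and
on the parity of n [power_sum_depletion].  Hence, modulo p^r,
(1 - eps p^n) E_n is a signed sum of powers of integers prime to p
[euler_factor_removed], and by Euler's theorem it has every common multiple Q
of 4 and phi(p^r) as a pure period [depleted_sum_periodic].  If moreover
Q >= r, then E_(n+Q) - E_n = - eps p^n E_n modulo p^r, so E_(n+Q) = E_n
modulo p^r if and only if p^r divides p^n E_n [euler_zigzag_period_eq].  For
n = r - j this says that p^j divides E_(r-j), and for n >= r it always holds;
the preperiod is the least t from which on it holds.

The truncated power sums come from the count of alternating permutations
through the boustrophedon triangle of Entringer numbers.  Up to the signs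
(-1)^(n/2), row by row, it is the difference table of the sequence of
coefficients of sech z; so, if [umbral] is the linear functional on integer
polynomials that sends X^n to the n-th of these coefficients, then X^m (X+1)^k
is sent to a signed Entringer number [umbral_entringer].  The two borders of the
triangle contain the E_n and zeros, which yields the functional equation
sech z * (exp z + exp (- z)) = 2 in the form
umbral (f (X + 1)) + umbral (f (X - 1)) = 2 f(0)  [umbral_shift]. *)

(** * The boustrophedon triangle of alternating permutations *)

(** Prescribing the last value instead of the first one makes the recurrence
direct: deleting the last entry of an alternating permutation leaves one
that has the same pattern, without complementation.  The classical
boustrophedon reads each row of this triangle in alternating directions. *)
Definition entringer (n k : nat) : nat :=
  #|[pred s : 'S_n.+1 | alternating s && (s ord_max == k :> nat)]|.

Lemma lift_perm_surj n (i j : 'I_n.+1) (s : 'S_n.+1) :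
  s i = j -> exists t : 'S_n, s = lift_perm i j t.
Proof.
move=> sij; have liftE k : exists l, s (lift i k) == lift j l.
  have := neq_lift i k; rewrite -(inj_eq (@perm_inj _ s)) sij.
  by case/unlift_some=> l -> _; exists l; apply: eqxx.
pose f k := xchoose (liftE k).
have fE k : s (lift i k) = lift j (f k) by exact: (eqP (xchooseP (liftE k))).
have f_inj : injective f.
  by move=> k l fkl; apply/(@lift_inj _ i)/(@perm_inj _ s); rewrite !fE fkl.
exists (perm f_inj); apply/permP=> k.
case: (unliftP i k) => [l|] ->; last by rewrite lift_perm_id.
by rewrite lift_perm_lift permE fE.
Qed.

(** Renumbering the values to make room for the last value k preserves their
order, so the only new condition is on the last step, which goes up when its
position n is even. *)
Lemma alternating_lift n (k : 'I_n.+2) (t : 'S_n.+1) :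
  alternating (lift_perm ord_max k t) =
  alternating t && (if odd n then k <= t ord_max else t ord_max < k).
Proof.
have lift_lt (a b : 'I_n.+1) : (lift k a < lift k b) = (a < b).
  by rewrite /= /bump; lia.
have liftl : (lift k (t ord_max) < k) = (t ord_max < k).
  by rewrite /= /bump; lia.
have liftr : (k < lift k (t ord_max)) = (k <= t ord_max).
  by rewrite /= /bump; lia.
apply/idP/andP=> [alt|[alt lst]].
  split.
    apply/forallP=> i; apply/forallP=> j; apply/implyP=> /eqP ji.
    move/forallP/(_ (lift ord_max i))/forallP/(_ (lift ord_max j)): alt.
    by rewrite !lift_perm_lift !lift_lt !lift_max ji eqxx.
  move/forallP/(_ (lift ord_max ord_max))/forallP/(_ ord_max): alt.
  by rewrite lift_perm_lift lift_perm_id liftl liftr !lift_max /= eqxx.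
apply/forallP=> i; apply/forallP=> j; apply/implyP=> /eqP ji.
case: (unliftP ord_max i) ji => [i'|] ->; last by move: (ltn_ord j) => /=; lia.
case: (unliftP ord_max j) => [j'|] -> ji.
  rewrite !lift_max in ji *; rewrite !lift_perm_lift !lift_lt.
  by move/forallP/(_ i')/forallP/(_ j'): alt; rewrite ji eqxx.
have -> : i' = ord_max by apply: val_inj; move: ji; rewrite lift_max /=; lia.
by rewrite lift_perm_lift lift_perm_id liftl liftr lift_max.
Qed.

Lemma entringer_sum n :
  euler_zigzag n.+1 = \sum_(0 <= l < n.+1) entringer n l.
Proof.
rewrite /euler_zigzag -sum1_card big_mkord.
rewrite (partition_big (fun s : 'S_n.+1 => s ord_max) predT) //=.
apply: eq_bigr => l _; rewrite /entringer -sum1_card.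
by apply: eq_bigl => s.
Qed.

(** Sort the permutations that end with k by the last value l that remains
after k is deleted and the values above it are lowered by one: the last step
comes down to k exactly if k <= l. *)
Lemma entringerS n k : k <= n.+1 ->
  entringer n.+1 k =
  \sum_(0 <= l < n.+1 | if odd n then k <= l else l < k) entringer n l.
Proof.
rewrite -ltnS => lt_k; pose K := Ordinal lt_k.
pose good (t : 'S_n.+1) :=
  alternating t && (if odd n then k <= t ord_max else t ord_max < k).
transitivity #|[pred t | good t]|.
  have inj : injective (@lift_perm n.+1 ord_max K).
    move=> s t /permP e; apply/permP=> i; move: (e (lift ord_max i)).
    by rewrite !lift_perm_lift => /lift_inj.
  rewrite -(card_image inj); apply: eq_card => s; rewrite inE.
  apply/andP/imageP => [[alt /eqP sk]|[t gt ->]].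
    have [t st] : exists t : 'S_n.+1, s = lift_perm ord_max K t.
      by apply: lift_perm_surj; apply: val_inj.
    by exists t => //; move: alt; rewrite st alternating_lift.
  by rewrite alternating_lift lift_perm_id.
rewrite -sum1_card big_mkord.
pose below (l : 'I_n.+1) := if odd n then k <= l else l < k.
rewrite (partition_big (fun s : 'S_n.+1 => s ord_max) below) /=; last first.
  by move=> s /andP[].
apply: eq_bigr => l bl; rewrite /entringer -sum1_card.
apply: eq_bigl => s; rewrite !inE /good -[s ord_max == l]val_eqE /=.
case: eqP => [->|_]; last by rewrite !andbF.
by rewrite !andbT; move: bl; rewrite /below => ->; rewrite andbT.
Qed.

Lemma euler_zigzag0 : euler_zigzag 0 = 1.
Proof.
rewrite /euler_zigzag (eq_card (B := predT)) ?card_perm ?card_ord // => [|s].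
  by rewrite card_Sn.
by rewrite !inE; apply/forallP => -[].
Qed.

Lemma entringer00 : entringer 0 0 = 1.
Proof.
have <- : euler_zigzag 1 = 1.
  rewrite /euler_zigzag (eq_card (B := predT)) ?card_Sn // => s.
  by rewrite !inE; apply/forallP => i; apply/forallP => j; rewrite !ord1.
by rewrite entringer_sum big_nat1.
Qed.

Lemma entringer_first0 n : odd n -> entringer n 0 = 0.
Proof. by case: n => // n /= /negPf e; rewrite entringerS // e big_pred0. Qed.

Lemma entringer_first n : ~~ odd n -> entringer n 0 = euler_zigzag n.
Proof.
case: n => [|n]; first by rewrite entringer00 euler_zigzag0.
by rewrite /= negbK => e; rewrite entringerS // e entringer_sum.
Qed.

Lemma entringer_last n : odd n -> entringer n n = euler_zigzag n.
Proof.
case: n => // n /= /negPf e; rewrite entringerS // e entringer_sum.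
rewrite big_nat_cond [RHS]big_nat_cond.
by apply: eq_bigl => i; rewrite andbT andbb.
Qed.

Lemma entringer_last0 n : 0 < n -> ~~ odd n -> entringer n n = 0.
Proof.
case: n => // n _ /=; rewrite negbK => e; rewrite entringerS // e.
by rewrite big_nat_cond big_pred0 // => i; lia.
Qed.

Import GRing.Theory.
Local Open Scope ring_scope.

(** * The umbral functional of the hyperbolic secant *)

Definition half_sign (n : nat) : int := (-1) ^+ n./2.

Lemma half_signS n : half_sign n.+1 = (-1) ^+ odd n * half_sign n.
Proof. by rewrite /half_sign -[n.+1./2]uphalfE uphalf_half exprD. Qed.

(** Consecutive entries of a row of the triangle are sums over the previous
row that differ by a single term. *)
Lemma entringer_diff n k : (k <= n)%N ->
  (entringer n.+1 k.+1)%:Z - (entringer n.+1 k)%:Z =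
  (-1) ^+ odd n * (entringer n k)%:Z.
Proof.
move=> le_kn; rewrite !entringerS ?ltnS ?(leqW le_kn) //.
rewrite -ltnS in le_kn; rewrite !big_mkord; pose K := Ordinal le_kn.
have neqE (l : 'I_n.+1) : (l != K) = (l != k :> nat) by [].
case: (odd n).
  rewrite [in X in _ - X](bigD1 K) //= PoszD opprD addrCA expr1 mulN1r.
  rewrite [X in _ + (Posz X - _)]
    (eq_bigl (fun l : 'I_n.+1 => (k <= l)%N && (l != K))).
    by rewrite subrr addr0.
  by move=> l; rewrite neqE; lia.
rewrite [in X in X - _](bigD1 K) //= PoszD expr0 mul1r -addrA.
rewrite [X in _ + (Posz X - _)](eq_bigl (fun l : 'I_n.+1 => (l < k)%N)).
  by rewrite subrr addr0.
by move=> l; rewrite neqE; lia.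
Qed.

(** The coefficient of z^n / n! in sech z. *)
Definition sech_coef (n : nat) : int := half_sign n * (entringer n 0)%:Z.

(** The functional that sends f to f (d/dz) applied to sech z at z = 0. *)
Definition umbral (f : {poly int}) : int :=
  \sum_(i < size f) f`_i * sech_coef i.

Lemma umbral_widen n (f : {poly int}) :
  (size f <= n)%N -> umbral f = \sum_(i < n) f`_i * sech_coef i.
Proof.
move=> le_n; rewrite -(subnKC le_n) big_split_ord /= [X in _ + X]big1 ?addr0 //.
by move=> i _; rewrite nth_default ?mul0r // leq_addr.
Qed.

Lemma umbral_is_linear : scalar umbral.
Proof.
move=> c f g; pose n := (size (f : {poly int}) + size (g : {poly int}))%N.
have [lef leg] : (size (f : {poly int}) <= n)%N /\
                 (size (g : {poly int}) <= n)%N.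
  by rewrite leq_addr leq_addl.
have leS : (size (c *: f + g : {poly int})%R <= n)%N.
  rewrite (leq_trans (size_polyD _ _)) // geq_max leg andbT.
  by rewrite (leq_trans (size_scale_leq _ _)).
rewrite (umbral_widen lef) (umbral_widen leg) (umbral_widen leS).
rewrite mulr_sumr -big_split /=; apply: eq_bigr => i _.
by rewrite coefD coefZ mulrDl mulrA.
Qed.

HB.instance Definition _ :=
  GRing.isLinear.Build int {poly int} int *%R umbral umbral_is_linear.

Lemma umbralXn n : umbral 'X^n = sech_coef n.
Proof.
rewrite (@umbral_widen n.+1) ?size_polyXn // (bigD1 ord_max) //= big1.
  by rewrite coefXn eqxx mul1r addr0.
by move=> i neq; rewrite coefXn (negPf (neq : (i != n :> nat))) mul0r.
Qed.

(** Both sides obey the same recurrence in k: multiplying by X + 1 is adding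
neighbouring entries of a difference table, and [entringer_diff] is that rule
up to the signs. *)
Lemma umbral_entringer m k :
  umbral ('X^m * ('X + 1) ^+ k) =
  half_sign (m + k) * (entringer (m + k) k)%:Z.
Proof.
elim: k m => [|k IHk] m; first by rewrite expr0 mulr1 umbralXn addn0.
have -> : 'X^m * ('X + 1) ^+ k.+1 =
    'X^(m.+1) * ('X + 1) ^+ k + 'X^m * ('X + 1) ^+ k :> {poly int}.
  by rewrite !exprS; ring.
rewrite linearD /= !IHk addSnnS addnS half_signS.
have /eqP := @entringer_diff (m + k) k (leq_addl _ _).
rewrite subr_eq => /eqP ->.
set a := (-1) ^+ odd (m + k); have aa : a * a = 1 by rewrite -expr2 sqrr_sign.
set h := half_sign _; set e := Posz (entringer _ _); set e' := Posz _.
have -> : a * h * (a * e' + e) = a * h * e + a * a * (h * e') by ring.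
by rewrite aa mul1r.
Qed.

Lemma umbral_XD1n n : odd n ->
  umbral (('X + 1) ^+ n) = half_sign n * (euler_zigzag n)%:Z.
Proof.
by move=> e; rewrite -[_ ^+ n]mul1r -(expr0 'X) umbral_entringer entringer_last.
Qed.

(** The functional vanishes on odd powers of X, since sech is even. *)
Lemma umbral_XB1n n :
  umbral (('X - 1) ^+ n) = (-1) ^+ n * umbral (('X + 1) ^+ n).
Proof.
rewrite !exprDn !linear_sum mulr_sumr /=; apply: eq_bigr => i _.
rewrite !linearMn /= mulrnAr; congr (_ *+ _).
have -> : 'X^(n - i) * (-1) ^+ i = (-1) ^+ i *: 'X^(n - i) :> {poly int}.
  by rewrite mulrC -mul_polyC rmorphXn rmorphN1.
rewrite linearZ /= expr1n mulr1 umbralXn /sech_coef.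
have [e|e] := boolP (odd (n - i)); first by rewrite entringer_first0 // !mulr0.
congr (_ * _); rewrite -signr_odd -[RHS]signr_odd; congr (_ ^+ _).
by move: (ltn_ord i) e; lia.
Qed.

(** By linearity it suffices to take f = X^n.  For n odd the two terms cancel
by parity; for n > 0 even both vanish, being the last entry of an even row. *)
Lemma umbral_shift (f : {poly int}) :
  umbral (f \Po ('X + 1)) + umbral (f \Po ('X - 1)) = 2 * f.[0].
Proof.
rewrite !comp_polyE !linear_sum /= horner_coef -big_split mulr_sumr /=.
apply: eq_bigr => i _; rewrite !linearZ /= umbral_XB1n.
rewrite -mulrDr [RHS]mulrCA; congr (_ * _).
have [e|e] := boolP (odd i).
  by rewrite -signr_odd e expr1 mulN1r subrr expr0n; case: i e => -[].
rewrite -signr_odd (negPf e) expr0 mul1r -[_ ^+ i]mul1r -(expr0 'X).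
rewrite umbral_entringer /= add0n expr0n.
case: (posnP i) e => [-> _|i0 e]; first by rewrite entringer00.
by rewrite entringer_last0 // mulr0.
Qed.

(** * Truncated alternating power sums *)

Lemma umbral_two_step n (y : int) :
  umbral (('X + y%:P) ^+ n) + umbral (('X + (y + 2)%:P) ^+ n) =
  2 * (y + 1) ^+ n.
Proof.
have := umbral_shift (('X + (y + 1)%:P) ^+ n).
rewrite !rmorphXn /= !comp_polyD !comp_polyX !comp_polyC.
rewrite horner_exp hornerD hornerX hornerC add0r => <-.
rewrite [LHS]addrC; congr (umbral (_ ^+ n) + umbral (_ ^+ n)).
  by rewrite -addrA -polyC1 -polyCD; congr (_ + _%:P); ring.
by rewrite -addrA -polyC1 -polyCN -polyCD; congr (_ + _%:P); ring.
Qed.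

Lemma umbral_telescope n N (y : int) :
  umbral (('X + y%:P) ^+ n) -
    (-1) ^+ N * umbral (('X + (y + (N.*2)%:Z)%:P) ^+ n) =
  2 * \sum_(0 <= j < N) (-1) ^+ j * (y + (j.*2.+1)%:Z) ^+ n.
Proof.
elim: N => [|N IHN]; first by rewrite big_geq // addr0 mul1r subrr mulr0.
rewrite big_nat_recr //= mulrDr -IHN mulrCA.
have -> : y + N.*2.+1%:Z = y + (N.*2)%:Z + 1 by lia.
rewrite -umbral_two_step.
have -> : y + N.+1.*2%:Z = y + (N.*2)%:Z + 2 by lia.
by rewrite exprS; ring.
Qed.

(** A polynomial with integer coefficients is unchanged modulo N by the
substitution of X + 2N for X, and the functional takes integral values. *)
Lemma umbral_shift_mod n N (y : int) :
  (N%:Z %| umbral (('X + (y + (N.*2)%:Z)%:P) ^+ n) -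
     umbral (('X + y%:P) ^+ n))%Z.
Proof.
rewrite -linearB /= subrXX.
have -> : 'X + (y + (N.*2)%:Z)%:P - ('X + y%:P) = (N.*2%:Z)%:P :> {poly int}.
  by rewrite polyCD; ring.
by rewrite mul_polyC linearZ /= -mul2n PoszM -mulrA mulrCA dvdz_mulr.
Qed.

(** The j-th positive integer of parity opposite to that of n. *)
Definition zigzag_base (n j : nat) : nat := (j.*2 + odd n).+1.

Definition zigzag_term (n j : nat) : int :=
  (-1) ^+ j * (zigzag_base n j)%:Z ^+ n.

(** Let u be the value of the functional at (X + b)^n, where b = 0 for n even
and b = 1 for n odd; by the borders of the triangle, u is E_n up to sign.
As N is odd, telescoping shows that u plus its shift by 2N is twice the
alternating sum, while modulo N the shift equals u; the factor 2 cancels. *)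
Lemma zigzag_power_sum n N : odd N ->
  (N%:Z %| half_sign n * (euler_zigzag n)%:Z -
     \sum_(0 <= j < N) zigzag_term n j)%Z.
Proof.
move=> oddN.
have umbralE : umbral (('X + (odd n)%:Z%:P) ^+ n) =
               half_sign n * (euler_zigzag n)%:Z.
  have [e|e] := boolP (odd n); first exact: umbral_XD1n.
  by rewrite addr0 umbralXn /sech_coef entringer_first.
have sumE : \sum_(0 <= j < N) zigzag_term n j =
            \sum_(0 <= j < N) (-1) ^+ j * ((odd n)%:Z + (j.*2.+1)%:Z) ^+ n.
  apply: eq_bigr => j _.
  by rewrite /zigzag_term -PoszD /zigzag_base addnS [(odd n + _)%N]addnC.
have dvd2 : coprimez N%:Z 2 by rewrite coprimezE coprimen2.
rewrite -umbralE sumE -(Gauss_dvdzr _ dvd2) mulrBr.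
rewrite -umbral_telescope -signr_odd oddN expr1 mulN1r opprK.
set u := umbral _; set v := umbral _.
have -> : 2 * u - (u + v) = - (v - u) by ring.
by rewrite rpredN umbral_shift_mod.
Qed.

(** * Removing the Euler factor at p *)

Lemma sum_residue_class (F : nat -> int) p c M : (c < p)%N ->
  \sum_(0 <= j < p * M | (j %% p == c)%N) F j =
  \sum_(0 <= i < M) F (p * i + c)%N.
Proof.
move=> lt_cp; elim: M => [|M IHM]; first by rewrite muln0 !big_geq.
rewrite big_nat_recr //= -IHM mulnS addnC.
rewrite (@big_cat_nat _ _ _ (p * M)%N) ?leq_addr //=; congr (_ + _).
rewrite -{1}[(p * M)%N]add0n big_addn addKn.
rewrite big_nat_cond (eq_bigl (fun j => (0 <= j < p)%N && (j == c))).
  by rewrite -big_nat_cond big_nat1_eq lt_cp addnC.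
move=> j; rewrite [(j + _)%N]addnC mulnC modnMDl.
by case: (ltnP j p) => // lt_jp; rewrite modn_small.
Qed.

(** The residue modulo p of the indices j for which p divides
[zigzag_base n j]: it is (p - 1) / 2 for n even and p - 1 for n odd. *)
Definition residue_index (p n : nat) : nat := ((odd n).+1 * p./2)%N.

Lemma dvdn_zigzag_base p n j : odd p ->
  (p %| zigzag_base n j)%N = (j %% p == residue_index p n)%N.
Proof.
move=> oddp; set c := residue_index p n.
have [cE lt_cp] : (c.*2 + (odd n).+1 = (odd n).+1 * p)%N /\ (c < p)%N.
  by rewrite /c /residue_index; case: (odd n); lia.
have baseE : (zigzag_base n j)%:Z = 2 * (j%:Z - c%:Z) + (odd n).+1%:Z * p%:Z.
  by rewrite -PoszM -cE /zigzag_base; lia.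
have dvd2 : coprimez p%:Z 2 by rewrite coprimezE coprimen2.
have -> : (p %| zigzag_base n j)%N = (p%:Z %| (zigzag_base n j)%:Z)%Z by [].
have dvdp : (odd n).+1%:Z * p%:Z \in dvdz p%:Z by rewrite dvdz_mull.
rewrite baseE (rpredDr _ dvdp) (Gauss_dvdzr _ dvd2) -eqz_mod_dvd !modz_nat.
by rewrite eqz_nat (modn_small lt_cp).
Qed.

Definition depleted_sum (p n N : nat) : int :=
  \sum_(0 <= j < N | ~~ (p %| zigzag_base n j)%N) zigzag_term n j.

(** This is the value at p of the nontrivial character modulo 4 for n even, and
1 for n odd. *)
Definition euler_sign (p n : nat) : int := (-1) ^+ residue_index p n.

(** The multiples of p of parity opposite to n are the p t with t of that
parity, and they are met at the indices p i + residue_index p n, whose sign is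
that of i up to a constant because p is odd. *)
Lemma power_sum_depletion p n M : odd p ->
  \sum_(0 <= j < p * M) zigzag_term n j =
  depleted_sum p n (p * M) +
  euler_sign p n * p%:Z ^+ n * \sum_(0 <= j < M) zigzag_term n j.
Proof.
move=> oddp; rewrite (bigID (fun j => p %| zigzag_base n j)%N) /= addrC.
congr (_ + _); rewrite (eq_bigl _ _ (fun j => dvdn_zigzag_base n j oddp)).
rewrite sum_residue_class; last first.
  by rewrite /residue_index; case: (odd n); move: oddp; lia.
rewrite mulr_sumr; apply: eq_bigr => i _; rewrite /zigzag_term.
have -> : zigzag_base n (p * i + residue_index p n) = (p * zigzag_base n i)%N.
  by rewrite /zigzag_base /residue_index; case: (odd n); move: oddp; nia.
rewrite PoszM exprMn exprD exprM -[(-1) ^+ p]signr_odd oddp expr1 /euler_sign.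
by ring.
Qed.

(** A sum of length p^(r+1), rather than p^r, is taken because the multiples of
p in it give a sum of length p^r, which is still E_n modulo p^r up to sign;
for n = 0 the coefficient p^n would not make up for a factor p lost there. *)
Lemma euler_factor_removed p n r : odd p ->
  ((p ^ r)%:Z %| (1 - euler_sign p n * p%:Z ^+ n) * (euler_zigzag n)%:Z -
     half_sign n * depleted_sum p n (p * p ^ r))%Z.
Proof.
move=> oddp; set s := half_sign n; set e := Posz (euler_zigzag n).
have ss : s * s = 1 by rewrite /s /half_sign -expr2 sqrr_sign.
have odd_pr : odd (p ^ r) by rewrite oddX oddp orbT.
have := zigzag_power_sum n odd_pr.
have : ((p ^ r)%:Z %| s * e - \sum_(0 <= j < p * p ^ r) zigzag_term n j)%Z.
  apply: dvdz_trans (zigzag_power_sum n _); last by rewrite oddM oddp.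
  by rewrite PoszM dvdz_mull.
rewrite power_sum_depletion // -/s -/e.
set D := depleted_sum _ _ _; set S := \sum_(0 <= j < _) _.
set c := _ * p%:Z ^+ n => dvd1 dvd2.
have -> : (1 - c) * e - s * D =
    s * (s * e - (D + c * S)) - s * c * (s * e - S) + (1 - s * s) * (1 - c) * e.
  by ring.
by rewrite ss subrr !mul0r addr0 rpredB // dvdz_mull.
Qed.

(** * Periodicity modulo a power of p *)

Lemma dvdz_exp_totient q t Q : coprime t q -> (totient q %| Q)%N ->
  (q%:Z %| t%:Z ^+ Q - 1)%Z.
Proof.
move=> co_tq /dvdnP[m ->].
have -> : t%:Z ^+ (m * totient q) - 1 =
          ((t ^ totient q) ^ m)%N%:Z - (1 ^ m)%N%:Z.
  by rewrite -!natz -expnM mulnC natrX exp1n.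
rewrite -eqz_mod_dvd !modz_nat eqz_nat -modnXm.
by rewrite (Euler_exp_totient co_tq) modnXm.
Qed.

Lemma depleted_sum_periodic p r Q n N : prime p -> ~~ odd Q ->
  (totient (p ^ r) %| Q)%N ->
  ((p ^ r)%:Z %| depleted_sum p (n + Q) N - depleted_sum p n N)%Z.
Proof.
move=> p_prime evenQ totQ.
have baseE j : zigzag_base (n + Q) j = zigzag_base n j.
  by rewrite /zigzag_base oddD (negPf evenQ) addbF.
rewrite /depleted_sum (eq_bigl (fun j => ~~ (p %| zigzag_base n j)%N)).
  rewrite -sumrB; apply: rpred_sum => j p_ndiv.
  rewrite /zigzag_term baseE -mulrBr exprD -[X in _ - X]mulr1 -mulrBr.
  rewrite !dvdz_mull // dvdz_exp_totient //.
  by rewrite coprime_sym coprimeXl // prime_coprime.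
by move=> j; rewrite baseE.
Qed.

(** Shifting n by Q preserves the depleted sum and both signs, but it kills the
Euler factor, because p^r divides p^(n+Q). *)
Lemma euler_zigzag_shift p r Q n :
    prime p -> odd p -> (4 %| Q)%N -> (totient (p ^ r) %| Q)%N -> (r <= Q)%N ->
  ((p ^ r)%:Z %| (euler_zigzag (n + Q))%:Z - (euler_zigzag n)%:Z +
                 euler_sign p n * (p ^ n * euler_zigzag n)%N%:Z)%Z.
Proof.
move=> p_prime oddp dvd4 totQ le_rQ.
have evenQ : ~~ odd Q by move: dvd4; lia.
have signE : half_sign (n + Q) = half_sign n.
  rewrite /half_sign -signr_odd -[RHS]signr_odd; congr (_ ^+ nat_of_bool _).
  by move: dvd4; lia.
have pE m : (p ^ m)%N%:Z = p%:Z ^+ m by rewrite -!natz natrX.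
have dvdQ : ((p ^ r)%:Z %| p%:Z ^+ (n + Q))%Z.
  by rewrite -pE dvdzE /= dvdn_exp2l // (leq_trans le_rQ) ?leq_addl.
have := depleted_sum_periodic n (p * p ^ r) p_prime evenQ totQ.
have := euler_factor_removed n r oddp.
have := euler_factor_removed (n + Q) r oddp.
rewrite signE PoszM (pE n) => dvd' dvd dvdD.
set d := depleted_sum p n _ in dvd dvdD *.
set d' := depleted_sum p (n + Q) _ in dvd' dvdD *.
move: (p%:Z ^+ (n + Q)) (euler_sign p (n + Q)) dvdQ dvd' => x c' dvdQ dvd'.
set e := Posz (euler_zigzag n) in dvd *; set c := euler_sign p n in dvd *.
set e' := Posz (euler_zigzag (n + Q)) in dvd' *.
have -> : e' - e + c * (p%:Z ^+ n * e) =
    ((1 - c' * x) * e' - half_sign n * d') -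
    ((1 - c * p%:Z ^+ n) * e - half_sign n * d) +
    half_sign n * (d' - d) + c' * e' * x by ring.
apply: rpredD; last exact: dvdz_mull.
by apply: rpredD; [exact: rpredB | exact: dvdz_mull].
Qed.

Lemma euler_zigzag_period_eq p r Q n :
    prime p -> odd p -> (4 %| Q)%N -> (totient (p ^ r) %| Q)%N -> (r <= Q)%N ->
  (euler_zigzag (n + Q) == euler_zigzag n %[mod p ^ r])%N =
  (p ^ r %| p ^ n * euler_zigzag n)%N.
Proof.
move=> p_prime oddp dvd4 totQ le_rQ.
rewrite -eqz_nat -!modz_nat eqz_mod_dvd.
have := euler_zigzag_shift n p_prime oddp dvd4 totQ le_rQ.
set x := _ - _.
rewrite -[(p ^ r %| _)%N]/((p ^ r)%:Z %| (p ^ n * euler_zigzag n)%N%:Z)%Z.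
set y := Posz (p ^ n * _) => dvd_sum.
have signy : ((p ^ r)%:Z %| euler_sign p n * y)%Z = ((p ^ r)%:Z %| y)%Z.
  by rewrite /euler_sign -signr_odd; case: odd; rewrite ?mulN1r ?rpredN ?mul1r.
rewrite -signy; apply/idP/idP => [dvdx|dvdy].
  by rewrite -(rpredDl _ dvdx).
by rewrite -(rpredDr _ dvdy).
Qed.

Local Close Scope ring_scope.

Theorem mainTheorem4 (p : nat) (p_prime : prime p) (p_odd : odd p)
    (r k : nat) (r_ge1 : 1 <= r) (k_ge1 : 1 <= k) (k_le_r : k <= r) :
  euler_preperiod (p ^ r) <= r - k <->
  (forall j : nat, 1 <= j <= k -> p ^ j %| euler_zigzag (r - j)).
Proof.
(* The factor r only serves to make Q at least r. *)
pose Q := 4 * r * totient (p ^ r); pose a n := euler_zigzag n %% p ^ r.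
have tot_gt0 : 0 < totient (p ^ r) by rewrite totient_gt0 expn_gt0 prime_gt0.
have Q_ge_r : r <= Q by rewrite /Q; nia.
have aQ n : (a (n + Q) == a n) = (p ^ r %| p ^ n * euler_zigzag n).
  apply: euler_zigzag_period_eq => //; last exact: dvdn_mull.
  by rewrite /Q -mulnA dvdn_mulr.
have perE n j : n = r - j -> j <= r ->
    (p ^ r %| p ^ n * euler_zigzag n) = (p ^ j %| euler_zigzag n).
  move=> nE le_jr; have -> : p ^ r = p ^ n * p ^ j by rewrite -expnD nE subnK.
  by rewrite dvdn_pmul2l // expn_gt0 prime_gt0.
have tailP n : r <= n -> a (n + Q) = a n.
  by move=> le_rn; apply/eqP; rewrite aQ dvdn_mulr // dvdn_exp2l.
have perQ : eventual_period a Q.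
  by split; [exact: leq_trans Q_ge_r | exists r].
have [pre_per pre_min] := preperiodP perQ.
split=> [le_pre j /andP[j_gt0 le_jk]|dvdE].
  have le_jr := leq_trans le_jk k_le_r.
  rewrite -(perE _ j) // -aQ; apply/eqP/pre_per/(leq_trans le_pre).
  exact: leq_sub2l.
apply: pre_min => n le_n; have [/tailP //|lt_nr] := leqP r n.
apply/eqP; rewrite aQ (perE _ (r - n)) ?leq_subr ?(subKn (ltnW lt_nr)) //.
by have := dvdE (r - n); rewrite (subKn (ltnW lt_nr)); apply; lia.
Qed.
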